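(* Let $A_{m,k}$ ($m,k\in\mathbb Z_{\ge0}$) be defined by $A_{0,0}=3^{1/4}$, $A_{0,k}=0$ for $k\ge1$, $A_{m,0}=0$ and $A_{m,2m}=\big(\tfrac{3\sqrt3}{2}\big)^m\frac{3^{1/4}}{m!}$ for $m\ge1$, and, for $m\ge1$ and $k\ge1$, $$\frac{k+1}{3}A_{m,k+1}-A_{m,k}+\frac{3\sqrt3}{k}A_{m-1,k-2}=0$$ (with $A_{m,k}=0$ whenever an index is negative). For $n\in\mathbb Z\setminus\{0\}$ let $\delta=\operatorname{sgn}(n)$ and $$W_n=\sum_{k=0}^{2|n|-2}A_{|n|-1,k}\Big(\frac{\delta s}{3}\Big)^k,\qquad s=3\Big(\frac z2\Big)^{2/3}.$$ Then for every $n\in\mathbb Z$ the Ohyama polynomial $\rho_n(s)$ is given by $$\rho_n=\begin{cases}3^{-1/4}\big(s/3\big)^{\frac{|n|-1}{4}}\,Wr(W_{\delta},W_{2\delta},\dots,W_n),& n\text{ odd},\\ \big(s/3\big)^{\frac{|n|}{4}}\,Wr(W_{\delta},W_{2\delta},\dots,W_n),& n\text{ even},\end{cases}$$ where the Wronskians are taken with respect to the variable $z$ (and the empty Wronskian for $n=0$ equals $1$).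
   Context: The Ohyama polynomials $\rho_n(s)$, $n\in\mathbb Z$, are defined by $\rho_0=\rho_1=\rho_{-1}=1$ and the recurrence $$(s+n)\rho_n^2-2s\rho_n\ddot\rho_n+2s(\dot\rho_n)^2-2\rho_n\dot\rho_n=\begin{cases}\rho_{n+1}\rho_{n-1},& n\text{ odd},\\ s\,\rho_{n+1}\rho_{n-1},& n\text{ even},\end{cases}$$ with dots denoting $\mathrm d/\mathrm ds$. The Wronskian is $Wr(f_1,\dots,f_N)=\det\big(\frac{\mathrm d^{i-1}f_j}{\mathrm dz^{i-1}}\big)_{i,j=1}^N$; here $W_j$ are regarded as functions of $z$ via $s=3(z/2)^{2/3}$, $z>0$. For $n>0$ the entries are $W_1,\dots,W_n$; for $n<0$ they are $W_{-1},W_{-2},\dots,W_n$. *)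

(* Defs.v *)
From mathcomp Require Import all_boot all_order all_algebra.
From mathcomp Require Import all_classical all_reals all_analysis.
Set Implicit Arguments. Unset Strict Implicit. Unset Printing Implicit Defensive.
Import Order.TTheory GRing.Theory Num.Theory.
Local Open Scope ring_scope.

Section Defs.
Variable R : realType.

Definition ohyama_rec (rho : int -> {poly R}) : Prop :=
  forall n : int,
    let p := rho n in
    ('X + (n%:~R)%:P) * p * p - 2%:P * 'X * p * p^`(2)
      + 2%:P * 'X * p^`() * p^`() - 2%:P * p * p^`()
    = if odd (absz n) then rho (n + 1) * rho (n - 1)
      else 'X * rho (n + 1) * rho (n - 1).

Definition is_ohyama (rho : int -> {poly R}) : Prop :=
  [/\ rho 0 = 1, rho 1 = 1, rho (-1) = 1 & ohyama_rec rho].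

Definition is_A (A : nat -> nat -> R) : Prop :=
  [/\ A 0%N 0%N = 3 `^ (1 / 4),
      (forall k, (1 <= k)%N -> A 0%N k = 0),
      (forall m, (1 <= m)%N -> A m 0%N = 0),
      (forall m, (1 <= m)%N ->
         A m (2 * m)%N = (3 * Num.sqrt 3 / 2) ^+ m * (3 `^ (1 / 4)) / (m`!)%:R)
    & (forall m k, (1 <= m)%N -> (1 <= k)%N ->
         (k.+1)%:R / 3 * A m k.+1 - A m k
         + 3 * Num.sqrt 3 / k%:R * (if (2 <= k)%N then A m.-1 (k - 2)%N else 0)
         = 0)].

Definition s_of_z (z : R) : R := 3 * (z / 2) `^ (2 / 3).

Definition Wfun (A : nat -> nat -> R) (j : int) (z : R) : R :=
  \sum_(k < (2 * absz j).-1)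
     A (absz j).-1 k * ((sgz j)%:~R * s_of_z z / 3) ^+ k.

(* Wronskian Wr(W_delta, W_{2 delta}, ..., W_n) with respect to z,
   delta = sgn n; the j-th column (0-based) is W_{delta (j+1)}.
   For n = 0 it is the empty determinant, equal to 1. *)
Definition WronskW (A : nat -> nat -> R) (n : int) (z : R) : R :=
  \det (\matrix_(i < absz n, j < absz n)
          derive1n i (Wfun A (sgz n * (j.+1)%:Z)) z).

End Defs.

(* Main.v *)
(* In the variable s the functions W_{m+1} are, up to constants, polynomials q_m
   with q_0 = 1 and q_{m+1}'' - q_{m+1}' = s q_m, a Jordan chain of a
   second-order operator.  Iterated Darboux transformations along the chain show
   that the Wronskians Om_n = Wr_s(q_0, ..., q_{n-1}) satisfy
     s (Om_{k+2}' Om_k - Om_{k+2} Om_k') - (s + k) Om_{k+2} Om_k = s^2 Om_{k+1}^2.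
   On the other side the Ohyama recurrence is a Toda equation.  With
   l_n = (log rho_n)', it propagates, together with a relation quadratic in
   l_{n+1} - l_n, the bilinear relation
     rho_{n+1} rho_{n-1} + rho_{n+1} rho_{n-1}' - rho_{n+1}' rho_{n-1}
       = s^[n odd] rho_n^2,
   which is the previous one for (-1)^C(n,2) s^floor((n-1)^2/4) rho_n.  Given the
   terms of index k and k+1, the relation determines the one of index k+2 up to a
   multiple of s^k e^s Om_k, which is not a polynomial, so both sequences agree.
   Negative indices reduce to positive ones by s -> -s, and the chain rule turns
   Wronskians in s into Wronskians in z. *)
Require Import Defs.
From mathcomp Require Import all_boot all_order all_algebra.
From mathcomp Require Import all_classical all_reals all_analysis.
From mathcomp Require Import ring lra zify.
Set Implicit Arguments. Unset Strict Implicit. Unset Printing Implicit Defensive.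
Import Order.TTheory GRing.Theory Num.Theory.
Import numFieldNormedType.Exports.
Local Open Scope ring_scope.

(** * Wronskians, Darboux transformations and the Toda equation in a differential field *)

Lemma det_lower_mul (K : comNzRingType) n (S M M' : nat -> nat -> K) :
  (forall i j, M' i j = \sum_(k < i.+1) S i k * M k j) ->
  \det (\matrix_(i < n, j < n) M' i j) =
  (\prod_(i < n) S i i) * \det (\matrix_(i < n, j < n) M i j).
Proof.
move=> defM'.
(* The hypothesis only involves [S i k] for [k <= i], so [S] is cut down to a triangular matrix. *)
pose T := \matrix_(i < n, j < n) (if (j <= i)%N then S i j else 0).
have Ttrig : is_trig_mx T.
  by apply/is_trig_mxP => i j lt_ij; rewrite mxE leqNgt lt_ij.
have -> : \matrix_(i < n, j < n) M' i j = T *m \matrix_(i < n, j < n) M i j.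
  apply/matrixP => i j; rewrite !mxE defM'.
  rewrite (big_ord_widen n (fun k => S i k * M k j) (ltn_ord i)).
  rewrite big_mkcond; apply: eq_bigr => k _ /=; rewrite !mxE ltnS.
  by case: ifP; rewrite ?mul0r.
rewrite det_mulmx det_trig //; congr (_ * _).
by apply: eq_bigr => i _; rewrite mxE leqnn.
Qed.

Definition derivation (F : nzRingType) (D : F -> F) :=
  {morph D : x y / x + y} /\ forall x y, D (x * y) = D x * y + x * D y.

Definition wronskian (F : nzRingType) (D : F -> F) n (f : nat -> F) : F :=
  \det (\matrix_(i < n, j < n) iter i D (f j)).

Section DifferentialField.
Variables (F : fieldType) (D : F -> F).
Hypothesis derD : derivation D.

Let DD : {morph D : x y / x + y} := derD.1.
Let DM : forall x y, D (x * y) = D x * y + x * D y := derD.2.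

Lemma derivation0 : D 0 = 0.
Proof. by have := DD 0 0; rewrite addr0 => /(congr1 (+%R^~ (- D 0))); rewrite addrK subrr. Qed.

Lemma derivation1 : D 1 = 0.
Proof.
have := DM 1 1; rewrite !mulr1 mul1r => /(congr1 (+%R^~ (- D 1))).
by rewrite addrK subrr.
Qed.

Lemma derivationN : {morph D : x / - x}.
Proof. by move=> x; apply/eqP; rewrite -addr_eq0 -DD addNr derivation0. Qed.

Lemma derivationB : {morph D : x y / x - y}.
Proof. by move=> x y; rewrite DD derivationN. Qed.

Lemma derivation_sum n (f : 'I_n -> F) :
  D (\sum_(i < n) f i) = \sum_(i < n) D (f i).
Proof. exact: (big_morph D DD derivation0). Qed.

Lemma derivation_natr n : D n%:R = 0.
Proof.
by elim: n => [|n IHn]; rewrite ?derivation0 // -addn1 natrD DD IHn add0r derivation1.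
Qed.

Lemma derivationV x : x != 0 -> D x^-1 = - (D x / x ^+ 2).
Proof.
move=> x0; have := DM x x^-1; rewrite divff // derivation1 => /esym/eqP.
rewrite addrC addr_eq0 => /eqP /(congr1 ( *%R x^-1)); rewrite mulKf // => ->.
by field.
Qed.

Lemma derivation_div x y :
  y != 0 -> D (x / y) = (D x * y - x * D y) / y ^+ 2.
Proof. by move=> y0; rewrite DM derivationV //; field. Qed.

(** The coefficients come from the Leibniz rule and do not depend on [h], so one row operation
    serves all columns of a Wronskian. *)
Lemma iter_twisted_derivation l i :
  {c : nat -> F | forall h, iter i D (D h - l * h) =
     \sum_(k < i.+1) - c k * iter k D h + iter i.+1 D h}.
Proof.
elim: i => [|i [c IHi]].
  by exists (fun=> l) => h; rewrite big_ord1 /= mulNr addrC.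
exists (fun k => (if (k <= i)%N then D (c k) else 0) + (if k is k'.+1 then c k' else 0)) => h.
rewrite iterS IHi DD derivation_sum -iterS; congr (_ + _).
under eq_bigr do rewrite DM derivationN -iterS.
under [RHS]eq_bigr do rewrite opprD mulrDl.
rewrite !big_split /=; congr (_ + _).
  rewrite [RHS]big_ord_recr /= ltnn oppr0 mul0r addr0.
  by apply: eq_bigr => k _; rewrite -ltnS ltn_ord.
by rewrite [RHS]big_ord_recl /= oppr0 mul0r add0r.
Qed.

(** The operator [D - l] with [l = D (f 0) / f 0] kills [f 0]; it is applied to the remaining terms,
    whence the shift of index. *)
Definition darboux (f : nat -> F) : nat -> F :=
  fun j => D (f j.+1) - D (f 0%N) / f 0%N * f j.+1.

(** Unitriangular row operations apply [D^i (D - l)] in row [i + 1]; the first column is then [f 0]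
    above zeros. *)
Lemma wronskian_darboux n f : f 0%N != 0 ->
  wronskian D n.+1 f = f 0%N * wronskian D n (darboux f).
Proof.
move=> f0; set l := D (f 0%N) / f 0%N.
pose c i := sval (iter_twisted_derivation l i).
have cP i h : iter i D (D h - l * h) =
    \sum_(k < i.+1) - c i k * iter k D h + iter i.+1 D h.
  exact: (svalP (iter_twisted_derivation l i)).
pose S i k : F := if k == i then 1 else if i is i'.+1 then - c i' k else 0.
pose M' i j := if i is i'.+1 then iter i' D (D (f j) - l * f j) else f j.
have defM' i j : M' i j = \sum_(k < i.+1) S i k * iter k D (f j).
  case: i => [|i]; first by rewrite big_ord1 /S /= mul1r.
  rewrite /M' cP [RHS]big_ord_recr /= /S eqxx mul1r; congr (_ + _).
  by apply: eq_bigr => k _; rewrite (ltn_eqF (ltn_ord k)).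
have /esym := @det_lower_mul F n.+1 S (fun i j => iter i D (f j)) M' defM'.
rewrite big1 => [|i _]; last by rewrite /S eqxx.
rewrite mul1r /wronskian => ->.
have lf0 : D (f 0%N) - l * f 0%N = 0 by rewrite /l divfK ?subrr.
have iter0 i : iter i D 0 = 0 by elim: i => //= i ->; rewrite derivation0.
rewrite (expand_det_col _ ord0) big_ord_recl big1 => [|i _]; last first.
  by rewrite mxE /M' /= lf0 iter0 mul0r.
rewrite addr0 mxE /=; congr (_ * _).
rewrite /cofactor /= expr0 mul1r; congr (\det _).
by apply/matrixP => i j; rewrite !mxE.
Qed.

Definition jordan_chain (s a b : F) (f : nat -> F) :=
  D (D (f 0%N)) + a * D (f 0%N) + b * f 0%N = 0 /\
  forall m, D (D (f m.+1)) + a * D (f m.+1) + b * f m.+1 = s * f m.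

(** As [f 0] is a solution, [D^2 + a D + b = (D + a + l) (D - l)] with [l = D (f 0) / f 0]. *)
Lemma darboux_factor s a b f m : f 0%N != 0 -> jordan_chain s a b f ->
  D (darboux f m) + (a + D (f 0%N) / f 0%N) * darboux f m = s * f m.
Proof.
move=> f0 [ch0 /(_ m) <-]; rewrite /darboux derivationB DM derivation_div //.
have -> : b = - (D (D (f 0%N)) + a * D (f 0%N)) / f 0%N.
  by apply: (mulIf f0); rewrite divfK //; apply/eqP; rewrite -addr_eq0 addrC ch0.
by field.
Qed.

(** The factors are exchanged: [(D - l) s^-1 (D + a + l)] lowers the index along the new chain, and
    moving [s^-1] past [D] produces the [- s^-1] in the first-order coefficient. *)
Lemma darboux_chain s a b f : s != 0 -> D s = 1 -> f 0%N != 0 ->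
  jordan_chain s a b f ->
  exists b', jordan_chain s (a - s^-1) b' (darboux f).
Proof.
move=> s0 Ds f0 ch; set l := D (f 0%N) / f 0%N.
have fac := darboux_factor _ f0 ch; rewrite -/l in fac.
exists (D a + D l - (a + l) / s - l * (a + l)).
have key m : D (D (darboux f m)) + (a - s^-1) * D (darboux f m) +
     (D a + D l - (a + l) / s - l * (a + l)) * darboux f m =
     s * (D (f m) - l * f m).
  have e1 := fac m; have e2 := congr1 D (fac m).
  rewrite DD !DM DD Ds mul1r in e2.
  have -> : s * (D (f m) - l * f m) =
    (f m + s * D (f m)) - (s * f m) / s - l * (s * f m) by field.
  by rewrite -e1 -e2; field.
split=> [|m]; rewrite key.
  by rewrite /l divfK // subrr mulr0.
by [].
Qed.

(* [Om k.+2 / Om k.+1] and [Om k / Om k.+1] come from consecutive factors of the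
   same second-order operator: this is the first-order equation
   [darboux_factor] written for ratios of Wronskians. *)
Lemma wronskian_bilinear s c b f k : s != 0 -> D s = 1 ->
  jordan_chain s (- 1 - c / s) b f ->
  (forall j, (j <= k.+1)%N -> wronskian D j f != 0) ->
  let Om := fun j => wronskian D j f in
  s * (D (Om k.+2) * Om k - Om k.+2 * D (Om k)) - (s + k%:R + c) * Om k.+2 * Om k
    = s ^+ 2 * Om k.+1 ^+ 2.
Proof.
move=> s0 Ds; elim: k c b f => [|k IHk] c b f ch nz Om.
  have W0 g : wronskian D 0 g = 1 by exact: det_mx00.
  have W1 g : wronskian D 1 g = g 0%N by rewrite /wronskian det_mx11 mxE.
  have f0 : f 0%N != 0 by rewrite -W1 nz.
  have := darboux_factor 0 f0 ch.
  rewrite /Om wronskian_darboux // !W1 W0 DM derivation1.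
  set g := darboux f 0%N => fac.
  have -> : D g = s * f 0%N - (- 1 - c / s + D (f 0%N) / f 0%N) * g.
    by rewrite -fac addrK.
  by field; rewrite s0 f0.
have f0 : f 0%N != 0.
  by have := nz 1%N isT; rewrite /wronskian det_mx11 mxE.
have [b' ch'] := darboux_chain s0 Ds f0 ch.
(* A transformation raises [c] by one while [k] drops by one, so [k + c] is preserved. *)
have ac : - 1 - c / s - s^-1 = - 1 - (c + 1) / s by field.
rewrite ac in ch'.
have nz' j : (j <= k.+1)%N -> wronskian D j (darboux f) != 0.
  by move=> lejk; have := nz j.+1 lejk; rewrite wronskian_darboux // mulf_eq0 negb_or f0.
have WD j : Om j.+1 = f 0%N * wronskian D j (darboux f) by exact: wronskian_darboux.
have /= E := IHk _ _ _ ch' nz'.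
rewrite /= !WD !DM exprMn [s ^+ 2 * (_ * _)]mulrCA -E -[k.+1%:R]natr1.
by ring.
Qed.

(* [l] is a logarithmic derivative, [y] a ratio [r n.+1 * r n.-1 / r n ^+ 2] up to
   a power of [s].  The quadratic hypothesis comes from the Riccati equation of
   the Darboux chain; differentiating it yields the first two conclusions. *)
Lemma toda_step s N e0 e1 l0 l1 l2 y0 y1 y2 :
  2%:R != 0 :> F -> s != 0 -> y1 != 0 -> D s = 1 -> D N = 0 ->
  (e0, e1) \in [:: (1, 0); (0, 1)] ->
  y0 = s + N - 2%:R * (s * D l0 + l0) ->
  y1 = s + (N + 1) - 2%:R * (s * D l1 + l1) ->
  y2 = s + (N + 2%:R) - 2%:R * (s * D l2 + l2) ->
  D y1 = y1 * (e1 / s + l2 - 2%:R * l1 + l0) ->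
  D y0 = (2%:R * (l1 - l0) - 1 + e0 / s) * y0 + s ->
  y0 + y1 = 2%:R * s * (l1 - l0) ^+ 2 - 2%:R * s * (l1 - l0)
     + (e0 - e1) * (l1 - l0) + 2%:R * s + 3%:R * N + 1 + e1 - 3%:R * (l0 + l1) ->
  [/\ y1 * (l2 - l0) = y1 - s,
      D y1 = (2%:R * (l2 - l1) - 1 + e1 / s) * y1 + s &
      y1 + y2 = 2%:R * s * (l2 - l1) ^+ 2 - 2%:R * s * (l2 - l1)
     + (e1 - e0) * (l2 - l1) + 2%:R * s + 3%:R * (N + 1) + 1 + e0 - 3%:R * (l1 + l2)].
Proof.
move=> nz2 s0 y10 Ds DN e01 T0 T1 T2 dy1 dy0 Q0.
have Dl0 : D l0 = (s + N - y0) / (2%:R * s) - l0 / s.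
  by rewrite T0; field; rewrite s0 nz2.
have Dl1 : D l1 = (s + (N + 1) - y1) / (2%:R * s) - l1 / s.
  by rewrite T1; field; rewrite s0 nz2.
have y1E : y1 = 2%:R * s * (l1 - l0) ^+ 2 - 2%:R * s * (l1 - l0)
     + (e0 - e1) * (l1 - l0) + 2%:R * s + 3%:R * N + 1 + e1 - 3%:R * (l0 + l1) - y0.
  by rewrite -Q0 addrC addKr.
have [D2 D3] := (derivation_natr 2, derivation_natr 3).
have De : D e0 = 0 /\ D e1 = 0.
  by move: e01; rewrite !inE => /orP[] /eqP[-> ->]; rewrite derivation0 derivation1.
have Q0' := congr1 D Q0.
rewrite !(DD, derivationN, DM, derivation1, D2, D3, De.1, De.2, Ds, DN) in Q0'.
(* The derivative of [Q0], with [D l0] and [D l1] eliminated by the Toda equations and [y1] by [Q0]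
   itself. Comparison with [dy1] then gives [C1]. *)
have dy1' : D y1 = (1 - 2%:R * (l1 - l0) + e1 / s) * y1 - s.
  have -> : D y1 = D y0 + D y1 - D y0 by rewrite addrC addKr.
  rewrite Q0' dy0 Dl0 Dl1 y1E.
  by move: e01; rewrite !inE => /orP[] /eqP[-> ->]; field; rewrite s0 nz2.
have C1 : y1 * (l2 - l0) = y1 - s.
  have -> : y1 * (l2 - l0) = D y1 - y1 * (e1 / s - 2%:R * l1 + 2%:R * l0).
    by rewrite dy1; field.
  by rewrite dy1'; field.
have l2E : l2 = l0 + (y1 - s) / y1 by rewrite -C1; field.
split=> //.
  have -> : (2%:R * (l2 - l1) - 1 + e1 / s) * y1 + s =
     D y1 + (y1 * (l2 - l0) - (y1 - s)) by rewrite dy1; field.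
  by rewrite C1 subrr addr0.
(* Once [Q0] eliminates [y0] and [C1] eliminates [l2], the last claim is a rational identity in [s],
   [N], [l0], [l1], [y1] for each value of [(e0, e1)]. *)
have y0E := addrK y1 y0; rewrite Q0 in y0E.
have Dl2 : D l2 = D l0 + ((D y1 - 1) * y1 - (y1 - s) * D y1) / y1 ^+ 2.
  by rewrite {1}l2E DD derivation_div // derivationB Ds.
rewrite T2 Dl2 dy1' Dl0 l2E -y0E.
by move: e01; rewrite !inE => /orP[] /eqP[-> ->]; field; rewrite s0 y10 nz2.
Qed.

Lemma toda_bilinear s (r : nat -> F) : 2%:R != 0 :> F -> s != 0 -> D s = 1 ->
  (forall n, r n != 0) -> r 0%N = 1 -> r 1%N = 1 ->
  (forall n, (s + n.+1%:R) * r n.+1 ^+ 2 - 2%:R * s * r n.+1 * D (D (r n.+1))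
     + 2%:R * s * D (r n.+1) ^+ 2 - 2%:R * r n.+1 * D (r n.+1)
   = (if odd n.+1 then 1 else s) * r n.+2 * r n) ->
  forall n, (if odd n.+1 then 1 else s) *
      (D (r n.+2) * r n - r n.+2 * D (r n) - r n.+2 * r n) = - s * r n.+1 ^+ 2.
Proof.
move=> nz2 s0 Ds r_neq0 r0 r1 toda.
(* [e n / s] is the logarithmic derivative of the parity factor [if odd n then 1 else s]. *)
pose e n : F := if odd n then 0 else 1.
pose l n := D (r n) / r n.
(* Taken from the left side of the Toda equation, not from the neighbours of [r n], so that it makes
   sense at [n = 0]. *)
pose y n := s + n%:R - 2%:R * (s * D (l n) + l n).
have yE n : y n.+1 = (if odd n.+1 then 1 else s) * r n.+2 * r n / r n.+1 ^+ 2.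
  by rewrite -toda /y /l derivation_div //; field.
have dy n : D (y n.+1) = y n.+1 * (e n.+1 / s + l n.+2 - 2%:R * l n.+1 + l n).
  rewrite yE /l /e expr2 derivation_div ?mulf_neq0 // !DM.
  by case: ifP => _; rewrite ?derivation1 ?Ds; field; rewrite ?s0 !r_neq0.
have y0 n : y n.+1 != 0.
  by rewrite yE !mulf_neq0 ?invr_eq0 ?expf_neq0 //; case: ifP => _; rewrite ?oner_neq0.
pose B n := D (y n) = (2%:R * (l n.+1 - l n) - 1 + e n / s) * y n + s.
pose Q n := y n + y n.+1 = 2%:R * s * (l n.+1 - l n) ^+ 2 - 2%:R * s * (l n.+1 - l n)
     + (e n - e n.+1) * (l n.+1 - l n) + 2%:R * s + 3%:R * n%:R + 1 + e n.+1
     - 3%:R * (l n + l n.+1).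
have step n : B n -> Q n ->
    [/\ y n.+1 * (l n.+2 - l n) = y n.+1 - s, B n.+1 & Q n.+1].
  move=> Bn Qn.
  have e01 : (e n, e n.+1) \in [:: (1, 0); (0, 1)].
    by rewrite /e /= !inE; case: (odd n); rewrite eqxx ?orbT.
  rewrite /B /Q -[n.+1%:R]natr1.
  have e2 : e n.+2 = e n by rewrite /e /= negbK.
  rewrite e2.
  apply: (@toda_step s n%:R _ _ _ _ _ (y n)) => //; rewrite ?derivation_natr //.
  - by rewrite /y -natr1.
  - by rewrite /y -natrD addn2.
have l0 : l 0%N = 0 by rewrite /l r0 derivation1 mul0r.
have l1 : l 1%N = 0 by rewrite /l r1 derivation1 mul0r.
have BQ n : B n /\ Q n.
  elim: n => [|n [Bn Qn]]; last by have [] := step n Bn Qn.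
  (* Base case: here [y 0 = s] and [y 1 = s + 1]. *)
  rewrite /B /Q /y l0 l1 /e /= derivation0 !(mulr0, addr0, subr0) Ds.
  by split; field.
move=> n; have [Bn Qn] := BQ n; have [C _ _] := step n Bn Qn.
have {}C : y n.+1 * (l n.+2 - l n - 1) = - s by rewrite mulrBr C; ring.
rewrite -C yE /l.
by case: ifP => _; field; rewrite !r_neq0.
Qed.

End DifferentialField.

(** * Extension of the derivative of polynomials to their field of fractions *)

Section QuotientDerivation.
Variables (K : idomainType) (F : fieldType) (iota : {rmorphism {poly K} -> F}).
Variables num den : F -> {poly K}.
Hypothesis iota_inj : injective iota.
Hypothesis den_neq0 : forall x, den x != 0.
Hypothesis num_den : forall x, x = iota (num x) / iota (den x).

Definition quotient_deriv (x : F) : F :=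
  iota ((num x)^`() * den x - num x * (den x)^`()) / iota (den x) ^+ 2.

Let iota_neq0 p : p != 0 -> iota p != 0.
Proof. by apply: contra_neq => h; apply: iota_inj; rewrite h rmorph0. Qed.

(** Independence of the representative: if [p / q = n / d], the claim is a combination of
    [p d = n q] and its derivative. *)
Lemma quotient_deriv_div p q : q != 0 ->
  quotient_deriv (iota p / iota q) = iota (p^`() * q - p * q^`()) / iota q ^+ 2.
Proof.
move=> q0; rewrite /quotient_deriv; set x := iota p / iota q.
have d0 := den_neq0 x; have := num_den x.
move: (num x) (den x) d0 => n d d0 /eqP.
rewrite /x eqr_div ?iota_neq0 // -!rmorphM => /eqP /iota_inj pdnq.
have := congr1 deriv pdnq; rewrite !derivM => pdnq'.
apply/eqP; rewrite eqr_div ?expf_neq0 ?iota_neq0 // -!rmorphXn -!rmorphM.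
apply/eqP; congr (iota _); apply/eqP; rewrite -subr_eq0; apply/eqP.
transitivity (- (q * d * ((p^`() * d + p * d^`()) - (n^`() * q + n * q^`())))
  + (p * d - n * q) * (q * d^`() + q^`() * d)); first by ring.
by rewrite pdnq pdnq' !subrr mulr0 mul0r oppr0 addr0.
Qed.

Lemma quotient_deriv_poly p : quotient_deriv (iota p) = iota p^`().
Proof.
rewrite -[iota p]divr1 -(rmorph1 iota) quotient_deriv_div ?oner_neq0 //.
by rewrite derivC mulr0 subr0 mulr1 rmorph1 expr1n divr1.
Qed.

Lemma quotient_deriv_derivation : derivation quotient_deriv.
Proof.
split=> x y; rewrite [x]num_den [y]num_den;
  move: (num x) (den x) (den_neq0 x) (num y) (den y) (den_neq0 y) => a b b0 c d d0.
- rewrite [iota a / _ + _](addf_div _ _ (iota_neq0 b0) (iota_neq0 d0)).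
  rewrite -!rmorphM -rmorphD !quotient_deriv_div ?mulf_neq0 // derivD !derivM.
  by rewrite !(rmorphB, rmorphM, rmorphD); field; rewrite !iota_neq0.
- rewrite [iota a / _ * (iota c / _)]mulf_div -!rmorphM.
  rewrite !quotient_deriv_div ?mulf_neq0 // !derivM.
  by rewrite !(rmorphB, rmorphM, rmorphD); field; rewrite !iota_neq0.
Qed.

End QuotientDerivation.

Lemma fractionE (R : idomainType) (x : {fraction R}) :
  x = FracField.tofrac (fraction.frac (generic_quotient.repr x)).1
      / FracField.tofrac (fraction.frac (generic_quotient.repr x)).2.
Proof.
rewrite -[x in LHS]reprK -[generic_quotient.repr x in LHS]Ratio_numden.
unlock FracField.tofrac.
rewrite -[X in _ * X]FracField.pi_inv -[RHS]FracField.pi_mul.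
rewrite /FracField.mulf /FracField.invf.
by rewrite !numden_Ratio ?oner_neq0 ?denom_ratioP // mulr1 mul1r.
Qed.

Lemma poly_differential_field (K : idomainType) :
  exists (F : fieldType) (D : F -> F) (iota : {rmorphism {poly K} -> F}),
    [/\ injective iota, derivation D & forall p, D (iota p) = iota p^`()].
Proof.
pose iota : {rmorphism {poly K} -> {fraction {poly K}}} := @FracField.tofrac {poly K}.
have iota_inj : injective iota.
  by move=> p q /eqP; rewrite tofrac_eq => /eqP.
have den0 (x : {fraction {poly K}}) : (fraction.frac (generic_quotient.repr x)).2 != 0.
  exact: denom_ratioP.
have numden := @fractionE {poly K}.
exists {fraction {poly K}},
  (quotient_deriv iota (fun x => (fraction.frac (generic_quotient.repr x)).1)
     (fun x => (fraction.frac (generic_quotient.repr x)).2)), iota.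
split=> //; first exact: quotient_deriv_derivation.
exact: quotient_deriv_poly.
Qed.

(** * Degree arguments, and transfer of the bilinear relations to polynomials *)

Section PolynomialRecurrences.
Variable K : idomainType.
Implicit Types p q u v : {poly K}.

Lemma mulX_small_eq0 p q : (size q <= size p)%N -> 'X * p = q -> p = 0.
Proof.
move=> le_qp def_q; apply/eqP/contraT => p0.
by move: le_qp; rewrite -def_q mulrC size_mulX // ltnn.
Qed.

Lemma size_mulX_deriv p q : (size ('X * (p * q^`()))%R <= size (p * q)%R)%N.
Proof.
have [->|p0] := eqVneq p 0; first by rewrite !mul0r mulr0.
have [->|q0] := eqVneq q 0; first by rewrite deriv0 !mulr0.
rewrite (size_mul p0 q0) mulrC.
have [->|pq'0] := eqVneq (p * q^`()) 0; first by rewrite mul0r size_poly0.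
rewrite size_mulX //; have := size_polyMleq p q^`(); have := lt_size_deriv q0.
have : (0 < size p)%N by rewrite size_poly_gt0.
lia.
Qed.

Lemma size_mul_deriv p q : (size (p * q^`())%R <= size (p * q)%R)%N.
Proof.
apply: leq_trans (size_mulX_deriv p q).
have [->|pq'0] := eqVneq (p * q^`()) 0; first by rewrite size_poly0.
by rewrite ['X * _]mulrC size_mulX.
Qed.

Lemma leq_sizeD p q n : (size p <= n -> size q <= n -> size (p + q)%R <= n)%N.
Proof. by move=> lep leq; apply: leq_trans (size_polyD _ _) _; rewrite geq_max lep. Qed.

Lemma leq_size_natrM k p n : (size p <= n -> size (k%:R * p)%R <= n)%N.
Proof.
move=> lep; apply: leq_trans lep; rewrite -polyC_natr mul_polyC.
exact: size_scale_leq.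
Qed.

(** The term ['X * p ^+ 2] has larger degree than all the others. *)
Lemma toda_form_neq0 p k : p != 0 ->
  ('X + k%:R) * p ^+ 2 - 2%:R * 'X * p * p^`()^`() + 2%:R * 'X * p^`() ^+ 2
    - 2%:R * p * p^`() != 0.
Proof.
move=> p0; apply/eqP => E; move: p0; apply/negP; rewrite negbK -(sqrf_eq0 p).
(* The equation solved for ['X * p ^+ 2]; negative terms are written with [*- 1] so that [szN]
   strips their sign. *)
apply/eqP; apply: (@mulX_small_eq0 _ (2%:R * ('X * (p * p^`()^`()))
   + (2%:R * ('X * (p^`() * p^`())) *- 1 + (2%:R * (p * p^`()) + k%:R * (p ^+ 2) *- 1)))).
  have szN (x : {poly K}) : size (x *- 1) = size x by rewrite mulr1n size_polyN.
  have spp : (size (p * p^`())%R <= size (p ^+ 2)%R)%N by rewrite expr2 size_mul_deriv.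
  repeat apply: leq_sizeD; rewrite ?szN; apply: leq_size_natrM => //.
  - exact: leq_trans (size_mulX_deriv _ _) spp.
  - by apply: leq_trans (size_mulX_deriv _ _) _; rewrite mulrC.
by apply/eqP; rewrite -subr_eq0 -E; apply/eqP; ring.
Qed.

(* The solutions of this first-order equation are the multiples of [s^k e^s p]. *)
Lemma bilinear_homogeneous_eq0 d p k : p != 0 ->
  'X * (d^`() * p - d * p^`()) - ('X + k%:R) * d * p = 0 -> d = 0.
Proof.
move=> p0 E; suff /eqP : d * p = 0 by rewrite mulf_eq0 (negPf p0) orbF => /eqP.
apply: (@mulX_small_eq0 _ (1%:R * ('X * (p * d^`())) +
   (1%:R * ('X * (d * p^`())) *- 1 + k%:R * (d * p) *- 1))).
  have szN (x : {poly K}) : size (x *- 1) = size x by rewrite mulr1n size_polyN.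
  repeat apply: leq_sizeD; rewrite ?szN; apply: leq_size_natrM => //.
  - by rewrite [d * p]mulrC size_mulX_deriv.
  - exact: size_mulX_deriv.
by apply/eqP; rewrite -subr_eq0 -[X in _ == X]oppr0 -E; apply/eqP; ring.
Qed.

(** The Ohyama recurrence at positive indices only; each half of the integers is brought to this
    form. *)
Definition toda_rec (r : nat -> {poly K}) := forall n,
  ('X + n.+1%:R) * r n.+1 ^+ 2 - 2%:R * 'X * r n.+1 * (r n.+1)^`()^`()
    + 2%:R * 'X * (r n.+1)^`() ^+ 2 - 2%:R * r n.+1 * (r n.+1)^`()
  = (if odd n.+1 then 1 else 'X) * r n.+2 * r n.

Lemma toda_neq0 r : r 0%N != 0 -> r 1%N != 0 -> toda_rec r -> forall n, r n != 0.
Proof.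
move=> r0 r1 toda n; suff: r n != 0 /\ r n.+1 != 0 by case.
elim: n => // n [rn rn1]; split=> //.
have := toda_form_neq0 n.+1 rn1; rewrite toda.
by rewrite !mulf_eq0 !negb_or => /andP[/andP[]].
Qed.

Lemma poly_toda_bilinear r : 2%:R != 0 :> K -> r 0%N = 1 -> r 1%N = 1 -> toda_rec r ->
  forall n, (if odd n.+1 then 1 else 'X) *
    ((r n.+2)^`() * r n - r n.+2 * (r n)^`() - r n.+2 * r n) = - 'X * r n.+1 ^+ 2.
Proof.
move=> nz2 r0 r1 toda n.
have r_neq0 : forall k, r k != 0 by apply: toda_neq0; rewrite ?r0 ?r1 ?oner_neq0.
have [F [D [iota [iota_inj derD Diota]]]] := poly_differential_field K.
have iota_eq0 p : (iota p == 0) = (p == 0) by rewrite -(rmorph0 iota) (inj_eq iota_inj).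
have iota_if (b : bool) : (if b then 1 else iota 'X) = iota (if b then 1 else 'X).
  by case: b; rewrite ?rmorph1.
apply: iota_inj.
rewrite [LHS]rmorphM [RHS]rmorphM rmorphXn !rmorphB !rmorphM rmorphN -iota_if -!Diota.
apply: (toda_bilinear derD (r := fun k => iota (r k))).
- rewrite -(rmorph_nat iota) iota_eq0 -polyC_natr polyC_eq0 //.
- by rewrite iota_eq0 polyX_eq0.
- by rewrite Diota derivX rmorph1.
- by move=> k; rewrite iota_eq0.
- by rewrite r0 rmorph1.
- by rewrite r1 rmorph1.
move=> k; rewrite iota_if !Diota -!(rmorph_nat iota) -!rmorphXn -!rmorphM -?rmorphD.
by rewrite -!rmorphM -rmorphB -rmorphD -rmorphB -toda.
Qed.

Lemma poly_wronskian_bilinear (q : nat -> {poly K}) :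
  q 0%N = 1 -> (forall m, (q m.+1)^`()^`() - (q m.+1)^`() = 'X * q m) ->
  let Om := fun j => wronskian deriv j q in
  forall k, (forall j, (j <= k.+1)%N -> Om j != 0) ->
  'X * ((Om k.+2)^`() * Om k - Om k.+2 * (Om k)^`()) - ('X + k%:R) * Om k.+2 * Om k
    = 'X ^+ 2 * Om k.+1 ^+ 2.
Proof.
move=> q0 qS Om k Om_neq0.
have [F [D [iota [iota_inj derD Diota]]]] := poly_differential_field K.
have iota_eq0 p : (iota p == 0) = (p == 0) by rewrite -(rmorph0 iota) (inj_eq iota_inj).
have iterD i p : iter i D (iota p) = iota (iter i deriv p).
  by elim: i => //= i ->.
have OmE j : wronskian D j (fun m => iota (q m)) = iota (Om j).
  rewrite /Om /wronskian -det_map_mx; congr (\det _).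
  by apply/matrixP => i l; rewrite !mxE iterD.
have X0 : iota 'X != 0 by rewrite iota_eq0 polyX_eq0.
have DX : D (iota 'X) = 1 by rewrite Diota derivX rmorph1.
(* The coefficients are [a = -1] and [b = 0]; the term [0 / iota 'X] records [c = 0]. *)
have ch : jordan_chain D (iota 'X) (- 1 - 0 / iota 'X) 0 (fun m => iota (q m)).
  split=> [|m]; rewrite mul0r subr0 mulN1r mul0r addr0.
    by rewrite !Diota q0 !derivC rmorph0 subr0.
  by rewrite !Diota -rmorphM -qS rmorphB.
have := wronskian_bilinear derD X0 DX ch (k := k).
rewrite /= !OmE addr0 => E; apply: iota_inj.
rewrite !(rmorphB, rmorphM, rmorphD, rmorphXn) rmorph_nat -!Diota.
by apply: E => j lejk; rewrite OmE iota_eq0 Om_neq0.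
Qed.

End PolynomialRecurrences.

(** * Signs and powers of [s] relating the Wronskians to the Toda sequence *)

(* [floor ((n - 1)^2 / 4)], including the value 0 at [n = 0]. *)
Definition wexp n := (n.-1./2 * n./2)%N.

Lemma wexpSS n : wexp n.+2 = (wexp n + n)%N.
Proof. by case: n => // n; rewrite /wexp /=; have := odd_double_half n; case: odd; nia. Qed.

(** Compares the powers of [s] on both sides of the rescaled relation; [odd n.+1] accounts for the
    parity factor. *)
Lemma wexp_double n : (2 * wexp n.+1 + 2 = 2 * wexp n + n + 1 + odd n.+1)%N.
Proof.
case: n => // n; rewrite /wexp /=; have := odd_double_half n; case: odd => /=; nia.
Qed.

Lemma mulX_derivXn (K : idomainType) n : 'X * ('X^n)^`() = n%:R * 'X^n :> {poly K}.
Proof. by case: n => [|n]; rewrite derivXn ?mulr0 ?mul0r // mulrnAr -exprS mulr_natl. Qed.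

Lemma sign_bin2 (K : nzRingType) n :
  (-1) ^+ 'C(n.+2, 2) * (-1) ^+ 'C(n, 2) = -1 :> K.
Proof.
rewrite -exprD 2!binS 2!bin1 -signr_odd !oddD /=.
by rewrite addbN; case: (odd _); case: (odd _).
Qed.

(** By [wexpSS], the powers of [s] in [R k.+2] and [R k] differ by [s^k], whose logarithmic
    derivative [k / s] supplies the term [k]; [sign_bin2] adjusts the sign of the right side. *)
Lemma scaled_bilinear (K : idomainType) (r : nat -> {poly K}) k :
  (if odd k.+1 then 1 else 'X) *
    ((r k.+2)^`() * r k - r k.+2 * (r k)^`() - r k.+2 * r k) = - 'X * r k.+1 ^+ 2 ->
  let R := fun n => (-1) ^+ 'C(n, 2) * 'X^(wexp n) * r n in
  'X * ((R k.+2)^`() * R k - R k.+2 * (R k)^`()) - ('X + k%:R) * R k.+2 * R k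
    = 'X ^+ 2 * R k.+1 ^+ 2.
Proof.
move=> H R.
have dR n : 'X * (R n)^`() =
    (-1) ^+ 'C(n, 2) * 'X^(wexp n) * ((wexp n)%:R * r n + 'X * (r n)^`()).
  rewrite /R !derivM -signr_odd; have -> : ((-1) ^+ odd 'C(n, 2))^`() = 0 :> {poly K}.
    by case: odd; rewrite ?expr1 ?expr0 ?derivN derivC ?oppr0.
  rewrite mul0r add0r; set e := (-1) ^+ _.
  transitivity (e * ('X * ('X^(wexp n))^`()) * r n + e * 'X^(wexp n) * ('X * (r n)^`())).
    by ring.
  by rewrite mulX_derivXn; ring.
have sq : ((-1) ^+ 'C(k.+1, 2)) ^+ 2 = 1 :> {poly K} by rewrite sqrr_sign.
have sg := sign_bin2 {poly K} k.
have wS := wexpSS k; have wd := wexp_double k.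
have -> : 'X * ((R k.+2)^`() * R k - R k.+2 * (R k)^`()) =
  ('X * (R k.+2)^`()) * R k - R k.+2 * ('X * (R k)^`()) by ring.
rewrite !dR /R.
set b := (-1) ^+ 'C(k.+2, 2) in sg *; set c := (-1) ^+ 'C(k, 2) in sg *.
set d := (-1) ^+ 'C(k.+1, 2) in sq *.
transitivity ((b * c) * ('X^(wexp k.+2) * 'X^(wexp k)) *
   ('X * ((r k.+2)^`() * r k - r k.+2 * (r k)^`() - r k.+2 * r k))).
  by rewrite wS natrD; ring.
transitivity (d ^+ 2 * ('X ^+ 2 * ('X^(wexp k.+1)) ^+ 2) * r k.+1 ^+ 2); last by ring.
rewrite sg sq -!exprM -!exprD.
have -> : (2 + wexp k.+1 * 2 = 2 * wexp k + k + 1 + odd k.+1)%N by lia.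
have -> : (wexp k.+2 + wexp k = 2 * wexp k + k)%N by lia.
case: (odd k.+1) H => /=; rewrite ?mul1r => H.
  rewrite H !exprD !expr1; ring.
rewrite H addn0 !exprD !expr1; ring.
Qed.

Theorem wronskian_toda (K : idomainType) (r q : nat -> {poly K}) :
  2%:R != 0 :> K -> r 0%N = 1 -> r 1%N = 1 -> toda_rec r ->
  q 0%N = 1 -> (forall m, (q m.+1)^`()^`() - (q m.+1)^`() = 'X * q m) ->
  forall n, wronskian deriv n q = (-1) ^+ 'C(n, 2) * 'X^(wexp n) * r n.
Proof.
move=> nz2 r0 r1 toda q0 qS.
have r_neq0 : forall n, r n != 0 by apply: toda_neq0; rewrite ?r0 ?r1 ?oner_neq0.
pose R n := (-1) ^+ 'C(n, 2) * 'X^(wexp n) * r n.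
have R_neq0 n : R n != 0.
  by rewrite !mulf_neq0 ?expf_neq0 ?polyX_eq0 // oppr_eq0 oner_neq0.
(* All smaller indices are carried along: the relation uses two previous terms and needs every
   earlier Wronskian to be nonzero. *)
suff: forall n j, (j <= n.+1)%N -> wronskian deriv j q = R j by move=> h n; apply: (h n).
elim=> [|n IHn] j.
  case: j => [_|[_|//]]; first by rewrite /wronskian det_mx00 /R r0 !mulr1.
  by rewrite /wronskian det_mx11 mxE /= q0 /R r1 !mulr1.
rewrite leq_eqVlt => /predU1P[->|]; last exact: IHn.
have W_neq0 i : (i <= n.+1)%N -> wronskian deriv i q != 0.
  by move=> lein; rewrite IHn.
have := poly_wronskian_bilinear q0 qS W_neq0.
have := scaled_bilinear (poly_toda_bilinear nz2 r0 r1 toda n).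
rewrite /= (IHn n.+1) // (IHn n) // -/(R n) -/(R n.+1) -/(R n.+2) => <- E.
(* Both terms of index [n.+2] solve the same inhomogeneous equation, so their difference solves the
   homogeneous one. *)
apply/eqP; rewrite -subr_eq0; apply/eqP.
apply: (bilinear_homogeneous_eq0 (R_neq0 n) (k := n)).
rewrite derivB; move/eqP: E; rewrite -subr_eq0 => /eqP <-; ring.
Qed.

Lemma deriv_comp_scale (R : comNzRingType) (p : {poly R}) (a : R) :
  (p \Po (a *: 'X))^`() = a *: (p^`() \Po (a *: 'X)).
Proof. by rewrite deriv_comp derivZ derivX alg_polyC mulrC mul_polyC. Qed.

(** * The chain rule from [s] to [z] *)

Section ChangeOfVariable.
Variable R : realType.
Implicit Types (z : R) (p : {poly R}).

(* The derivative of [s_of_z]. *)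
Definition t_of_z z : R := (z / 2) `^ (- (1 / 3)).

Lemma is_derive_powR_half (a z : R) : 0 < z ->
  is_derive z 1 (fun x : R => (x / 2) `^ a) (a * (z / 2) `^ (a - 1) / 2).
Proof.
move=> z0.
have -> : (fun x : R => (x / 2) `^ a) = (@powR R)^~ a \o (fun x => 2^-1 * x).
  by apply/funext => x /=; rewrite mulrC.
have z20 : 0 < 2^-1 * z by rewrite mulr_gt0 // invr_gt0.
have dg : is_derive z 1 (fun x : R => 2^-1 * x) (2^-1).
  by apply: is_derive_eq; rewrite ?scaler1 //.
have df := is_derive1_powR a z20.
rewrite [z / 2]mulrC.
exact: is_derive1_comp.
Qed.

Lemma is_derive_s z : 0 < z -> is_derive z 1 (@s_of_z R) (t_of_z z).
Proof.
move=> z0; have d := is_derive_powR_half (2 / 3) z0.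
have -> : t_of_z z = 3 *: (2 / 3 * (z / 2) `^ (2 / 3 - 1) / 2).
  rewrite /t_of_z /GRing.scale /=; have -> : 2 / 3 - 1 = - (1 / 3) :> R by field.
  by field.
exact: is_deriveZ.
Qed.

Lemma is_derive_t z : 0 < z ->
  is_derive z 1 t_of_z (- (6^-1) * t_of_z z ^+ 4).
Proof.
move=> z0; have d := is_derive_powR_half (- (1 / 3)) z0.
apply: (is_derive_eq d); rewrite /t_of_z -powR_mulrn ?powR_ge0 // -powRrM.
have -> : - (1 / 3) * 4%:R = - (1 / 3) - 1 :> R by field.
by field.
Qed.

(* Since [dt/dz = - t^4 / 6], the operator [(d/dz)^i] is a combination of the
   [(d/ds)^k], [k <= i], with coefficients polynomial in [t = ds/dz]. *)
Fixpoint chain_coef i k : {poly R} :=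
  if i is i'.+1 then
    (- (6^-1)) *: 'X^4 * (chain_coef i' k)^`()
      + (if k is k'.+1 then 'X * chain_coef i' k' else 0)
  else (k == 0%N)%:R.

Lemma chain_coef_gt i k : (i < k)%N -> chain_coef i k = 0.
Proof.
elim: i k => [|i IHi] [|k] //= ltik.
by rewrite !IHi ?deriv0 ?mulr0 ?addr0 // ltnW.
Qed.

(** Of these triangular coefficients, a determinant sees only the diagonal. *)
Lemma chain_coef_diag i : chain_coef i i = 'X^i.
Proof.
elim: i => [|i IHi] //=.
by rewrite chain_coef_gt // deriv0 mulr0 add0r IHi exprS.
Qed.

Lemma is_derive_chain_term (a b : {poly R}) z : 0 < z ->
  is_derive z 1 (fun x => a.[t_of_z x] * b.[s_of_z x])
    (((- (6^-1)) *: 'X^4 * a^`()).[t_of_z z] * b.[s_of_z z]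
      + ('X * a).[t_of_z z] * b^`().[s_of_z z]).
Proof.
move=> z0.
have dt := is_derive_t z0; have ds := is_derive_s z0.
have da : is_derive z 1 (horner a \o t_of_z) (a^`().[t_of_z z] * (- (6^-1) * t_of_z z ^+ 4)).
  exact: is_derive1_comp.
have db : is_derive z 1 (horner b \o @s_of_z R) (b^`().[s_of_z z] * t_of_z z).
  exact: is_derive1_comp.
have dM := is_deriveM da db.
apply: (is_derive_eq dM).
rewrite /GRing.scale /= !hornerE /=; ring.
Qed.

Lemma derive1n_comp_s p i z : 0 < z ->
  derive1n i (fun x => p.[s_of_z x]) z =
  \sum_(k < i.+1) (chain_coef i k).[t_of_z z] * (iter k deriv p).[s_of_z z].
Proof.
elim: i z => [|i IHi] z z0.
  by rewrite big_ord1 /= hornerE mul1r.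
rewrite derive1nS derive1E.
(* The induction hypothesis holds only for positive arguments, so the functions are compared near
   [z]. *)
rewrite (near_eq_derive (g := fun x =>
  \sum_(k < i.+1) (chain_coef i k).[t_of_z x] * (iter k deriv p).[s_of_z x])); last first.
  near=> x; apply: IHi; near: x; exact: lt_nbhsr.
have dk (k : 'I_i.+1) := is_derive_chain_term (chain_coef i k) (iter k deriv p) z0.
have := is_derive_sum dk.
rewrite fct_sumE => d; rewrite (@derive_val _ _ _ _ _ _ _ d) big_split /=.
under [RHS]eq_bigr do rewrite /= hornerD mulrDl.
rewrite big_split /=; congr (_ + _).
  rewrite [RHS]big_ord_recr /= chain_coef_gt // deriv0 mulr0 horner0 mul0r addr0.
  by [].
by rewrite [RHS]big_ord_recl /= horner0 mul0r add0r.
Unshelve. all: by end_near.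
Qed.

End ChangeOfVariable.

(** As [t = (s / 3)^(-1/2)], this turns [t^C(n,2) (s / 3)^(wexp n)] into the power [([n odd] - n) /
    4] of [s / 3]. *)
Lemma wexp_bin2 n : (4 * wexp n + n = 2 * 'C(n, 2) + odd n)%N.
Proof.
suff: (4 * wexp n + n = 2 * 'C(n, 2) + odd n)%N /\
      (4 * wexp n.+1 + n.+1 = 2 * 'C(n.+1, 2) + odd n.+1)%N by case.
elim: n => // n [IH1 IH2]; split=> //; rewrite wexpSS 2!binS 2!bin1 /= negbK; lia.
Qed.

Lemma horner_comp_scale (K : comNzRingType) (p : {poly K}) (a x : K) :
  (p \Po (a *: 'X)).[x] = p.[a * x].
Proof. by rewrite horner_comp hornerZ hornerX. Qed.

(** * The polynomials [W] as a Jordan chain, and their Wronskian in [z] *)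

Section OhyamaWronskian.
Variables (R : realType) (A : nat -> nat -> R).
Hypothesis AP : is_A A.

Let c : R := 3 `^ (1 / 4).
(** In the variable [s], three times that of [Apoly], the recurrence reads
    [P_{m+1}'' - P_{m+1}' = kappa s P_m]; dividing [P_m] by [kappa^m] normalises it. *)
Let kappa : R := - (Num.sqrt 3 / 3).

Let c_neq0 : c != 0. Proof. by rewrite gt_eqF // powR_gt0. Qed.
Let kappa_neq0 : kappa != 0.
Proof. by rewrite oppr_eq0 mulf_neq0 ?invr_eq0 ?pnatr_eq0 // gt_eqF // sqrtr_gt0. Qed.

Definition Apoly m : {poly R} := \poly_(k < (2 * m).+1) A m k.

Lemma Apoly0 : Apoly 0 = c%:P.
Proof.
case: AP => A00 _ _ _ _.
by rewrite /Apoly /= poly_def big_ord1 A00 expr0 alg_polyC.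
Qed.

(** Up to degree [2 m] this is the recurrence of [A]. In degree [2 m + 1] truncation removes the
    second derivative, and the closed form of the top coefficients takes over. *)
Lemma Apoly_rec m :
  (Apoly m.+1)^`()^`() - 3 *: (Apoly m.+1)^`() = - (9 * Num.sqrt 3) *: ('X * Apoly m).
Proof.
case: AP => A00 A0S AS0 Atop Arec; apply/polyP => k.
rewrite !(coefB, coefZ, coef_deriv, coefXM, coef_poly).
have k1 : k.+1%:R != 0 :> R by rewrite pnatr_eq0.
have rec : k.+2%:R * A m.+1 k.+2 - 3 * A m.+1 k.+1 =
   - (9 * Num.sqrt 3) / k.+1%:R * (if (0 < k)%N then A m k.-1 else 0).
  have := Arec m.+1 k.+1 isT isT; rewrite /= subSS subn1 ltnS => /eqP.
  rewrite addr_eq0 => /eqP E.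
  have -> : k.+2%:R * A m.+1 k.+2 - 3 * A m.+1 k.+1 =
    3 * (k.+2%:R / 3 * A m.+1 k.+2 - A m.+1 k.+1) by field.
  by rewrite E; field.
have [lek|ltk] := leqP k (2 * m).
  have -> : (k.+2 < (2 * m.+1).+1)%N by lia.
  have -> : (k.+1 < (2 * m.+1).+1)%N by lia.
  have -> : (if k == 0%N then 0 else if (k.-1 < (2 * m).+1)%N then A m k.-1 else 0) =
      (if (0 < k)%N then A m k.-1 else 0).
    by rewrite lt0n; case: eqP => //= _; rewrite ltnS (leq_trans (leq_pred k) lek).
  transitivity (k.+1%:R * (k.+2%:R * A m.+1 k.+2 - 3 * A m.+1 k.+1)); first by ring.
  by rewrite rec; field.
have k0 : (k == 0%N) = false by apply/negbTE; rewrite -lt0n (leq_ltn_trans _ ltk).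
rewrite k0.
have [ek|nek] := eqVneq k (2 * m).+1.
  have -> : (k.+2 < (2 * m.+1).+1)%N = false by lia.
  have -> : (k.+1 < (2 * m.+1).+1)%N by lia.
  have -> : (k.-1 < (2 * m).+1)%N by lia.
  rewrite ek /= !mul0rn sub0r.
  have -> : A m.+1 (2 * m).+2 = 3 * Num.sqrt 3 / 2 / m.+1%:R * A m (2 * m).
    have -> : ((2 * m).+2 = 2 * m.+1)%N by lia.
    rewrite Atop // factS natrM exprS; have m1 : m.+1%:R != 0 :> R by rewrite pnatr_eq0.
    have fm : m`!%:R != 0 :> R by rewrite pnatr_eq0 -lt0n fact_gt0.
    (* The case [m = 0] is apart because the closed form is only given for [m >= 1]. *)
    case: m m1 fm {rec ltk k1 k0 ek} => [|m] m1 fm.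
      by rewrite A00 fact0 expr0; field.
    by rewrite Atop //; field; rewrite fm -natrD pnatr_eq0.
  have m1 : m.+1%:R != 0 :> R by rewrite pnatr_eq0.
  rewrite -[_ *+ (2 * m).+2]mulr_natr.
  have -> : (2 * m).+2%:R = 2 * m.+1%:R :> R by rewrite -natrM; congr (_%:R); lia.
  by field.
have -> : (k.+2 < (2 * m.+1).+1)%N = false by lia.
have -> : (k.+1 < (2 * m.+1).+1)%N = false by lia.
have -> : (k.-1 < (2 * m).+1)%N = false by lia.
by rewrite !mul0rn !mulr0 subr0.
Qed.

Definition qpoly m : {poly R} := (c * kappa ^+ m)^-1 *: (Apoly m \Po (3^-1 *: 'X)).

Lemma qpoly0 : qpoly 0 = 1.
Proof. by rewrite /qpoly Apoly0 comp_polyC expr0 mulr1 -mul_polyC -polyCM mulVf. Qed.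

Lemma qpoly_rec m : (qpoly m.+1)^`()^`() - (qpoly m.+1)^`() = 'X * qpoly m.
Proof.
rewrite /qpoly !derivZ !deriv_comp_scale !derivZ !deriv_comp_scale.
have := congr1 (fun p => p \Po (3^-1 *: 'X)) (Apoly_rec m).
rewrite /= comp_polyB !comp_polyZ comp_polyM comp_polyX => E.
have -> : (Apoly m.+1)^`()^`() \Po (3^-1 *: 'X) =
  3 *: ((Apoly m.+1)^`() \Po (3^-1 *: 'X)) +
   - (9 * Num.sqrt 3) *: (3^-1 *: 'X * (Apoly m \Po (3^-1 *: 'X))).
  by rewrite -E addrC subrK.
rewrite -scalerAl -scalerAr.
set y := _ \Po _; set w := 'X * _.
have sqrt3E : Num.sqrt 3 = - 3 * kappa by rewrite /kappa; field.
apply/polyP => i; rewrite !(coefZ, coefD, coefN) sqrt3E exprS.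
by field; rewrite kappa_neq0 c_neq0 expf_neq0.
Qed.

Lemma qpoly_horner m x : (Apoly m).[x / 3] = c * kappa ^+ m * (qpoly m).[x].
Proof.
rewrite /qpoly hornerZ mulrA divff ?mul1r; last by rewrite mulf_neq0 ?expf_neq0.
by rewrite horner_comp_scale mulrC.
Qed.

Lemma Wfun_qpoly (d : R) (n : int) j : n != 0 -> d = (sgz n)%:~R ->
  Wfun A (sgz n * j.+1%:Z) =
  fun z => ((c * kappa ^+ j) *: (qpoly j \Po (d *: 'X))).[s_of_z z].
Proof.
move=> n0 dE; apply/funext => z; rewrite /Wfun.
have -> : absz (sgz n * j.+1%:Z) = j.+1.
  by rewrite abszM; case: sgzP n0 => //= _ _; rewrite mul1n.
have -> : sgz (sgz n * j.+1%:Z) = sgz n.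
  by rewrite sgzM sgz_id mulr1.
rewrite hornerZ horner_comp_scale -qpoly_horner horner_poly -dE.
by rewrite mulnS.
Qed.

Lemma iter_deriv_scale (a b : R) (p : {poly R}) k :
  iter k deriv (a *: (p \Po (b *: 'X))) = (a * b ^+ k) *: (iter k deriv p \Po (b *: 'X)).
Proof.
elim: k => [|k IHk]; first by rewrite mulr1.
by rewrite !iterS IHk derivZ deriv_comp_scale scalerA exprSr mulrA.
Qed.

(** Row operations from the chain rule contribute [(t d)^i] in row [i], and column [j] contributes
    [c kappa^j]; the exponents [i] and [j] add up to [C(|n|, 2)]. *)
Lemma WronskW_poly (n : int) (d z : R) : n != 0 -> d = (sgz n)%:~R -> 0 < z ->
  WronskW A n z =
   (t_of_z z * d) ^+ 'C(absz n, 2) * (c ^+ absz n * kappa ^+ 'C(absz n, 2)) *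
   (wronskian deriv (absz n) qpoly).[d * s_of_z z].
Proof.
move=> n0 dE z0; rewrite /WronskW.
set m := absz n; set s := s_of_z z; set t := t_of_z z.
pose M k j := (c * kappa ^+ j) * (iter k deriv (qpoly j)).[d * s].
pose S i k := (chain_coef R i k).[t] * d ^+ k.
pose M' i j := derive1n i (Wfun A (sgz n * j.+1%:Z)) z.
have defM' i j : M' i j = \sum_(k < i.+1) S i k * M k j.
  rewrite /M' (Wfun_qpoly j n0 dE) derive1n_comp_s //; apply: eq_bigr => k _.
  rewrite iter_deriv_scale hornerZ horner_comp_scale /S /M.
  by rewrite -/s -/t; ring.
have bin2E k : 'C(k, 2) = (\sum_(i < k) i)%N by rewrite -bin2_sum big_mkord.
rewrite (@det_lower_mul R m S M M' defM').
have -> : \prod_(i < m) S i i = (t * d) ^+ 'C(m, 2).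
  rewrite bin2E expr_sum; apply: eq_bigr => i _.
  by rewrite /S chain_coef_diag hornerXn exprMn.
rewrite -mulrA; congr (_ * _).
have -> : \matrix_(i < m, j < m) M i j =
    map_mx (horner_eval (d * s)) (\matrix_(i < m, j < m) iter i deriv (qpoly j))
      *m diag_mx (\row_(j < m) (c * kappa ^+ j)).
  apply/matrixP => i j; rewrite mul_mx_diag !mxE /horner_eval /M.
  by rewrite mulrC.
rewrite det_mulmx det_map_mx det_diag mulrC; congr (_ * _).
under eq_bigr do rewrite mxE.
by rewrite big_split /= prodr_const card_ord bin2E expr_sum.
Qed.

Lemma powR_collect (a : R) m N e : 0 < a ->
  (a `^ (1 / 4)) ^+ m * (a `^ (- (1 / 2))) ^+ N * a ^+ e =
  a `^ (m%:R / 4 - N%:R / 2 + e%:R).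
Proof.
move=> a0; have an0 : a != 0 by rewrite gt_eqF.
have aI (x y : R) : a `^ (x + y) = a `^ x * a `^ y by rewrite powRD // an0 implybT.
rewrite -!powR_mulrn ?powR_ge0 ?ltW // -!powRrM -!aI; congr (_ `^ _).
by field.
Qed.

Lemma t_of_zE (z : R) : t_of_z z = (s_of_z z / 3) `^ (- (1 / 2)).
Proof.
rewrite /t_of_z /s_of_z mulrAC divff ?mul1r ?pnatr_eq0 // -powRrM.
by congr (_ `^ _); field.
Qed.

Lemma kappaE : - kappa = 3 `^ (- (1 / 2)).
Proof.
have -> : - (1 / 2) = 2^-1 - 1 :> R by field.
rewrite powRD ?pnatr_eq0 ?implybT // powR12_sqrt ?ler0n // powRN powRr1 ?ler0n //.
by rewrite /kappa opprK.
Qed.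

(** [r] stays abstract because it will be [rho] for positive [n] and a signed reflection of [rho]
    for negative [n]. *)
Lemma WronskW_toda (n : int) (d z : R) (r : nat -> {poly R}) :
  n != 0 -> d = (sgz n)%:~R -> 0 < z ->
  r 0%N = 1 -> r 1%N = 1 -> toda_rec r ->
  let m := absz n in let u := s_of_z z / 3 in
  WronskW A n z = d ^+ ('C(m, 2) + wexp m) * (r m).[d * s_of_z z] *
    (if odd m then 3 `^ (1 / 4) * u `^ (- ((m%:R - 1) / 4)) else u `^ (- (m%:R / 4))).
Proof.
move=> n0 dE z0 r0 r1 toda m u; rewrite (WronskW_poly n0 dE z0) -/m.
have nz2 : 2%:R != 0 :> R by rewrite pnatr_eq0.
rewrite (wronskian_toda nz2 r0 r1 toda qpoly0 qpoly_rec) !hornerM hornerXn.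
rewrite horner_exp hornerN hornerC.
have u0 : 0 < u by rewrite /u /s_of_z mulrAC divff ?mul1r ?pnatr_eq0 // powR_gt0 // divr_gt0.
have sE : s_of_z z = 3 * u by rewrite /u; field.
have e3 := powR_collect m 'C(m, 2) (wexp m) (ltr0n R 3).
have eu := powR_collect 0 'C(m, 2) (wexp m) u0.
rewrite -/c -kappaE in e3; rewrite expr0 mul1r -t_of_zE in eu.
have -> : (if odd m then 3 `^ (1 / 4) * u `^ (- ((m%:R - 1) / 4)) else u `^ (- (m%:R / 4)))
   = (c ^+ m * (- kappa) ^+ 'C(m, 2) * 3 ^+ wexp m) * (t_of_z z ^+ 'C(m, 2) * u ^+ wexp m).
  rewrite e3 eu.
  have we : 4 * (wexp m)%:R + m%:R = 2 * 'C(m, 2)%:R + (odd m)%:R :> R.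
    by rewrite -!natrM -!natrD wexp_bin2.
  have -> : m%:R / 4 - 'C(m, 2)%:R / 2 + (wexp m)%:R = (odd m)%:R / 4 :> R by lra.
  have -> : 0%:R / 4 - 'C(m, 2)%:R / 2 + (wexp m)%:R = ((odd m)%:R - m%:R) / 4 :> R by lra.
  case: (odd m) => /=; first by congr (_ `^ _ * _ `^ _); field.
  by rewrite mul0r powRr0 mul1r; congr (_ `^ _); field.
(* The sign [(-1)^C(m,2)] from [wronskian_toda] is absorbed in passing from [kappa] to [- kappa],
   which is a real power of 3. *)
by rewrite sE [in RHS]exprNn !exprMn exprD; ring.
Qed.

End OhyamaWronskian.

(** * Positive and negative indices, and the final formula *)

Lemma toda_rec_pos (R : realType) (rho : int -> {poly R}) :
  is_ohyama rho -> toda_rec (fun k => rho k%:Z).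
Proof.
case=> _ _ _ rec k; have := rec k.+1%:Z; rewrite /= => E.
have E1 : (k.+1%:Z + 1 = k.+2%:Z)%R by lia.
have E2 : (k.+1%:Z - 1 = k%:Z)%R by lia.
rewrite E1 E2 in E.
transitivity (if ~~ odd k then rho k.+2 * rho k else 'X * rho k.+2 * rho k); last first.
  by case: odd; rewrite /= ?mul1r.
rewrite -E !polyC_natr; ring.
Qed.

(** Under [s -> -s], [n -> -n] the left side changes sign and the neighbours swap; the signs [e0],
    [e1], [e2] restore the equation. *)
Lemma toda_reflect_identity (K : comNzRingType) (b : bool)
    (x k p p1 p2 u v e0 e1 e2 : K) :
  e1 ^+ 2 = 1 -> e2 * e0 = (if b then -1 else 1) ->
  (- x - k) * p * p - 2 * - x * p * p2 + 2 * - x * p1 * p1 - 2 * p * p1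
    = (if b then u * v else - x * u * v) ->
  (x + k) * (e1 * p) ^+ 2 - 2 * x * (e1 * p) * (e1 * - - p2)
    + 2 * x * (e1 * - p1) ^+ 2 - 2 * (e1 * p) * (e1 * - p1)
    = (if b then 1 else x) * (e2 * v) * (e0 * u).
Proof.
move=> e11 e20 E.
transitivity (- (e1 ^+ 2) *
  ((- x - k) * p * p - 2 * - x * p * p2 + 2 * - x * p1 * p1 - 2 * p * p1)).
  by ring.
rewrite E e11.
transitivity (e2 * e0 * ((if b then 1 else x) * v * u)); last by ring.
by rewrite e20; case: b {E e20}; ring.
Qed.

(** The sign is the one that [WronskW_toda] produces for [d = -1]. *)
Lemma toda_rec_neg (R : realType) (rho : int -> {poly R}) : is_ohyama rho ->
  toda_rec (fun k => (-1) ^+ ('C(k, 2) + wexp k) *: (rho (- k%:Z) \Po (-1 *: 'X))).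
Proof.
case=> _ _ _ rec k; have /(congr1 (fun p => p \Po (-1 *: 'X))) := rec (- k.+1%:Z).
have -> : (- k.+1%:Z + 1 = - k%:Z)%R by lia.
have -> : (- k.+1%:Z - 1 = - k.+2%:Z)%R by lia.
rewrite abszN mulrNz -pmulrn absz_nat.
set a := rho (- k%:Z); set p := rho (- k.+1%:Z); set b := rho (- k.+2%:Z).
rewrite (fun_if (fun q => q \Po (-1 *: 'X))).
rewrite !(comp_polyB, comp_polyD, comp_polyM, comp_polyC, comp_polyX)
  !polyC_natr polyCN polyC_natr => E.
rewrite !derivZ !deriv_comp_scale !derivZ !deriv_comp_scale.
set sg0 := (-1) ^+ ('C(k, 2) + _); set sg1 := (-1) ^+ ('C(k.+1, 2) + _).
set sg2 := (-1) ^+ ('C(k.+2, 2) + _).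
have sg11 : sg1 ^+ 2 = 1 by rewrite /sg1 sqrr_sign.
have sg20 : sg2 * sg0 = if odd k.+1 then -1 else 1.
  (* The binomials contribute [-1] and, by [wexpSS], the other exponents contribute [(-1)^k]. *)
  rewrite /sg2 /sg0 (exprD _ 'C(k.+2, 2)) (exprD _ 'C(k, 2)) mulrACA sign_bin2
    -exprD wexpSS addnAC addnn.
  by rewrite -signr_odd oddD odd_double /=; case: odd; rewrite ?expr1 ?expr0 ?mulrNN ?mulr1.
move: E; set X' := -1 *: 'X; have -> : X' = - 'X :> {poly R} by rewrite /X' scaleN1r.
rewrite -[p^`(2)]/(p^`()^`()) !scaleN1r -!mul_polyC.
set P := p \Po _; set P1 := p^`() \Po _; set P2 := p^`()^`() \Po _.
set Pa := a \Po _; set Pb := b \Po _ => E.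
have {}sg11 : sg1%:P ^+ 2 = 1 :> {poly R} by rewrite -polyC_exp sg11.
have {}sg20 : sg2%:P * sg0%:P = (if odd k.+1 then -1 else 1) :> {poly R}.
  by rewrite -polyCM sg20; case: odd; rewrite ?polyCN.
exact: toda_reflect_identity.
Qed.

Theorem theorem3 (R : realType) (A : nat -> nat -> R) (rho : int -> {poly R}) :
  is_A A -> is_ohyama rho ->
  forall (n : int) (z : R), 0 < z ->
    let s := s_of_z z in
    (rho n).[s] =
      if odd (absz n) then
        3 `^ (- (1 / 4)) * (s / 3) `^ (((absz n)%:R - 1) / 4) * WronskW A n z
      else
        (s / 3) `^ ((absz n)%:R / 4) * WronskW A n z.
Proof.
move=> AP rhoP n z z0 s.
have [r0 r1 rN1 _] := rhoP.
have [->|n0] := eqVneq n 0.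
  by rewrite r0 hornerC /= mul0r powRr0 mul1r /WronskW det_mx00.
pose d : R := (sgz n)%:~R; set m := absz n.
(* With the sign matching [WronskW_toda], only real powers of [3] and [s / 3] remain to be
   cancelled. *)
suff [r [r_0 r_1 toda rE]] : exists r : nat -> {poly R},
    [/\ r 0%N = 1, r 1%N = 1, toda_rec r &
        (rho n).[s] = d ^+ ('C(m, 2) + wexp m) * (r m).[d * s]].
  rewrite (WronskW_toda AP n0 (erefl d) z0 r_0 r_1 toda) -/m -/s -rE.
  have u0 : s / 3 != 0.
    by rewrite /s /s_of_z mulrAC divff ?mul1r ?pnatr_eq0 // gt_eqF // powR_gt0 // divr_gt0.
  have can (a x : R) : a != 0 -> a `^ x * a `^ (- x) = 1.
    by move=> a0; rewrite -powRD ?subrr ?powRr0 // a0 implybT.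
  case: (odd m).
    rewrite mulrCA mulrACA [3 `^ _ * _]mulrC (can 3) ?pnatr_eq0 //.
    by rewrite (can _ _ u0) !mulr1.
  by rewrite mulrCA can // mulr1.
case: n n0 @d @m => k n0 d m.
- exists (fun k => rho k%:Z); split=> //; first exact: toda_rec_pos.
  have -> : d = 1 by rewrite /d gtr0_sgz // lt0r n0.
  by rewrite expr1n !mul1r.
- exists (fun k => (-1) ^+ ('C(k, 2) + wexp k) *: (rho (- k%:Z) \Po (-1 *: 'X))).
  have -> : d = -1 by rewrite /d ltr0_sgz // mulrN1z.
  split; last 1 first.
  + by rewrite hornerZ horner_comp_scale mulrA -exprD -signr_odd addnn
      odd_double mul1r mulrA mulrNN !mul1r.
  + by rewrite oppr0 r0 comp_polyC scale1r.
  + by rewrite rN1 comp_polyC scale1r.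
  + exact: toda_rec_neg.
Qed.
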